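(* For every nonempty set $\mathcal{D}$ of discounting functions, the strict model-checking problem for $\mathrm{LTL}^{\mathrm{disc}\oplus}[\mathcal{D}]$ is undecidable: there is no algorithm that, given a finite Kripke structure $\mathcal{K}$, an $\mathrm{LTL}^{\mathrm{disc}\oplus}[\mathcal{D}]$ formula $\varphi$ and a threshold $v\in[0,1]$, decides whether $[\![\mathcal{K},\varphi]\!]>v$.
   Context: Let $AP$ be a finite set of atomic propositions. A computation is $\pi=\pi_0\pi_1\cdots\in(2^{AP})^\omega$, $\pi^i=\pi_i\pi_{i+1}\cdots$. A discounting function is a strictly decreasing $\eta:\mathbb{N}\to[0,1]$ with $\lim_{i\to\infty}\eta(i)=0$. $\mathrm{LTL}^{\mathrm{disc}\oplus}[\mathcal{D}]$ formulas: $\varphi ::= \mathtt{True}\mid p\mid\neg\varphi\mid\varphi\vee\varphi\mid\mathsf{X}\varphi\mid\varphi\,\mathsf{U}\,\varphi\mid\varphi\,\mathsf{U}_\eta\,\varphi\mid\varphi\oplus\varphi$ ($p\in AP$, $\eta\in\mathcal{D}$), with values: $[\![\pi,\mathtt{True}]\!]=1$; $[\![\pi,p]\!]=1$ if $p\in\pi_0$, else $0$; $[\![\pi,\neg\varphi]\!]=1-[\![\pi,\varphi]\!]$; $[\![\pi,\varphi\vee\psi]\!]=\max\{[\![\pi,\varphi]\!],[\![\pi,\psi]\!]\}$; $[\![\pi,\mathsf{X}\varphi]\!]=[\![\pi^1,\varphi]\!]$; $[\![\pi,\varphi\,\mathsf{U}\,\psi]\!]=\sup_{i\ge0}\min\{[\![\pi^i,\psi]\!],\min_{0\le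 j<i}[\![\pi^j,\varphi]\!]\}$; $[\![\pi,\varphi\,\mathsf{U}_\eta\,\psi]\!]=\sup_{i\ge0}\min\{\eta(i)[\![\pi^i,\psi]\!],\min_{0\le j<i}\eta(j)[\![\pi^j,\varphi]\!]\}$; $[\![\pi,\varphi\oplus\psi]\!]=\frac{[\![\pi,\varphi]\!]+[\![\pi,\psi]\!]}{2}$. A Kripke structure $\mathcal{K}=\langle AP,S,I,\rho,L\rangle$ has finite state set $S$, initial states $I\subseteq S$, total transition relation $\rho\subseteq S\times S$, labeling $L:S\to2^{AP}$; its computations are $L(s_0)L(s_1)\cdots$ for infinite paths with $s_0\in I$, $(s_i,s_{i+1})\in\rho$. $[\![\mathcal{K},\varphi]\!]=\inf\{[\![\pi,\varphi]\!]:\pi$ a computation of $\mathcal{K}\}$. *)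

(* Defs.v *)
From HB Require Import structures.
From mathcomp Require Import all_boot all_order all_algebra.
From mathcomp Require Import all_classical all_reals.
From mathcomp Require Import topology normedtype sequences.
From mathcomp Require Import Rstruct Rstruct_topology.


Set Implicit Arguments.
Unset Strict Implicit.
Unset Printing Implicit Defensive.
Import Order.TTheory GRing.Theory Num.Theory.
Import numFieldNormedType.Exports.
Local Open Scope classical_set_scope.
Local Open Scope ring_scope.

Notation RR := Rdefinitions.R.

Definition discounting (eta : nat -> RR) : Prop :=
  (forall i, 0 <= eta i <= 1) /\
  (forall i j : nat, (i < j)%N -> eta j < eta i) /\
  (eta @ \oo --> (0 : RR)).

(* Syntax of LTL^{disc (+)}[D].  Atomic propositions are named by      *)
(* natural numbers; discounting functions are named by natural numbers *)
(* (a name i denotes delta i, where delta : nat -> (nat -> R) names    *)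
(* elements of D).                                                     *)

Inductive ltl : Type :=
| FTrue : ltl
| FAtom : nat -> ltl
| FNeg  : ltl -> ltl
| FOr   : ltl -> ltl -> ltl
| FNext : ltl -> ltl
| FUntil : ltl -> ltl -> ltl
| FDUntil : nat -> ltl -> ltl -> ltl
| FAvg  : ltl -> ltl -> ltl.

(* computations: pi i = the set of atomic propositions true at position i *)
Definition computation := nat -> seq nat.

Definition suffix (pi : computation) (i : nat) : computation := fun k => pi (i + k)%N.

(* finite minimum over j < i; the empty minimum is 1 (all values lie in [0,1]) *)
Definition fmin (i : nat) (F : nat -> RR) : RR := \big[Num.min/1]_(j < i) F j.

Fixpoint sem (delta : nat -> nat -> RR) (f : ltl) (pi : computation) : RR :=
  match f with
  | FTrue => 1
  | FAtom p => if p \in pi 0%N then 1 else 0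
  | FNeg g => 1 - sem delta g pi
  | FOr g h => Num.max (sem delta g pi) (sem delta h pi)
  | FNext g => sem delta g (suffix pi 1)
  | FUntil g h =>
      sup [set Num.min (sem delta h (suffix pi i))
                       (fmin i (fun j => sem delta g (suffix pi j))) | i in [set: nat]]
  | FDUntil e g h =>
      sup [set Num.min (delta e i * sem delta h (suffix pi i))
                       (fmin i (fun j => delta e j * sem delta g (suffix pi j)))
          | i in [set: nat]]
  | FAvg g h => (sem delta g pi + sem delta h pi) / 2
  end.

Record kripke : Type := Kripke {
  nst : nat;                    (* number of states; S = {0,..,nst-1} *)
  kinit : seq nat;
  ktrans : seq (nat * nat);
  klab : seq (seq nat)          (* labelling: klab`_s = L(s) *)
}.

Definition kripke_wf (K : kripke) : Prop :=
  [/\ all (fun s => s < nst K)%N (kinit K),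
      kinit K != [::],
      all (fun e => (e.1 < nst K)%N && (e.2 < nst K)%N) (ktrans K),
      (forall s, (s < nst K)%N -> exists t, (s, t) \in ktrans K)
    & size (klab K) = nst K].

Definition is_path (K : kripke) (s : nat -> nat) : Prop :=
  s 0%N \in kinit K /\ forall i, (s i, s i.+1) \in ktrans K.

Definition is_computation (K : kripke) (pi : computation) : Prop :=
  exists s, is_path K s /\ pi = (fun i => nth [::] (klab K) (s i)).

Definition kval (delta : nat -> nat -> RR) (K : kripke) (f : ltl) : RR :=
  inf [set sem delta f pi | pi in is_computation K].

(* Model of computation: Kleene's unary basis of partial recursive     *)
(* functions on nat, using the Cantor pairing.                         *)

Definition cpair (a b : nat) : nat := (((a + b) * (a + b).+1) %/ 2 + b)%N.

(* inverse of cpair, by enumerating the Cantor diagonals *)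
Fixpoint cunpair (n : nat) : nat * nat :=
  match n with
  | 0 => (0, 0)%N
  | m.+1 => let: (a, b) := cunpair m in
            if a is a'.+1 then (a', b.+1) else (b.+1, 0%N)
  end.

Inductive prog : Type :=
| PZero : prog
| PSucc : prog
| PId   : prog
| PFst  : prog
| PSnd  : prog
| PPair : prog -> prog -> prog
| PComp : prog -> prog -> prog
| PRec  : prog -> prog -> prog
| PMu   : prog -> prog.

Inductive eval : prog -> nat -> nat -> Prop :=
| ev_zero x : eval PZero x 0
| ev_succ x : eval PSucc x x.+1
| ev_id x : eval PId x x
| ev_fst x : eval PFst x (cunpair x).1
| ev_snd x : eval PSnd x (cunpair x).2
| ev_pair f g x a b : eval f x a -> eval g x b -> eval (PPair f g) x (cpair a b)
| ev_comp f g x y z : eval g x y -> eval f y z -> eval (PComp f g) x z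
| ev_rec0 f g x y : eval f x y -> eval (PRec f g) (cpair 0 x) y
| ev_recS f g n x y z :
    eval (PRec f g) (cpair n x) y -> eval g (cpair n (cpair y x)) z ->
    eval (PRec f g) (cpair n.+1 x) z
| ev_mu f x n :
    eval f (cpair n x) 0 ->
    (forall m, (m < n)%N -> exists k, eval f (cpair m x) k.+1) ->
    eval (PMu f) x n.

Fixpoint enc_list (l : seq nat) : nat :=
  if l is x :: l' then (cpair x (enc_list l')).+1 else 0%N.

Fixpoint enc_ltl (f : ltl) : nat :=
  match f with
  | FTrue => cpair 0 0
  | FAtom p => cpair 1 p
  | FNeg g => cpair 2 (enc_ltl g)
  | FOr g h => cpair 3 (cpair (enc_ltl g) (enc_ltl h))
  | FNext g => cpair 4 (enc_ltl g)
  | FUntil g h => cpair 5 (cpair (enc_ltl g) (enc_ltl h))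
  | FDUntil e g h => cpair 6 (cpair e (cpair (enc_ltl g) (enc_ltl h)))
  | FAvg g h => cpair 7 (cpair (enc_ltl g) (enc_ltl h))
  end.

Definition enc_kripke (K : kripke) : nat :=
  cpair (nst K)
    (cpair (enc_list (kinit K))
       (cpair (enc_list [seq cpair e.1 e.2 | e <- ktrans K])
              (enc_list [seq enc_list l | l <- klab K]))).

(* instance (K, phi, v) with rational threshold v = p / q *)
Definition enc_instance (K : kripke) (f : ltl) (p q : nat) : nat :=
  cpair (enc_kripke K) (cpair (enc_ltl f) (cpair p q)).

Definition strict_mc (delta : nat -> nat -> RR) (K : kripke) (f : ltl) (p q : nat) : Prop :=
  (p%:R / q%:R : RR) < kval delta K f.

Definition decides_strict_mc (delta : nat -> nat -> RR) (c : prog) : Prop :=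
  forall (K : kripke) (f : ltl) (p q : nat),
    kripke_wf K -> (0 < q)%N -> (p <= q)%N ->
    (strict_mc delta K f p q -> eval c (enc_instance K f p q) 1) /\
    (~ strict_mc delta K f p q -> eval c (enc_instance K f p q) 0).

(* Main.v *)
From HB Require Import structures.
Require Import Defs.
From mathcomp Require Import all_boot all_order all_algebra.
From mathcomp Require Import all_classical all_reals.
From mathcomp Require Import Rstruct.
From mathcomp Require Import zify lra.
Local Open Scope classical_set_scope.
Set Implicit Arguments.
Unset Strict Implicit.

(** The halting problem of counter machines is encoded as follows. A configuration
    is a letter naming the control state, after which the atom of register [i]
    first occurs at distance equal to the value of [i]; the value of [True U_eta i]
    is eta of that distance. Since eta is strictly decreasing, [(f (+) ~g) \/ (g (+) ~f)]
    has value 1/2 + |f - g|/2, which exceeds 1/2 exactly when the two distances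
    disagree, so "some configuration is not followed by its successor, or is final"
    is expressible as "value > 1/2". If the machine diverges, the encoding of its
    run has value at most 1/2. If it halts, every computation errs (or halts) among
    finitely many configurations, whose register values bound the errors away from
    0, so the infimum exceeds 1/2.

    Given a program [c] deciding the problem, let [M] be the machine which on
    input [x] computes the instance obtained by plugging the input constraint
    "register 0 is [x]" into the Kripke structure and formula coded by [x], runs [c]
    on it and halts iff the answer is 0. Running [M] on the code of its own Kripke
    structure and formula is contradictory. As only this plugging has to be computed
    by a program, neither a universal program nor a computable compiler is needed,
    and only the direction "evaluation implies machine run" of the simulation. *)

(** * Counter machines and compilation of programs *)

Lemma cpairE a b : cpair a b = (((a + b) * (a + b).+1) %/ 2 + b)%N.
Proof. by []. Qed.

Lemma triangleS n : (n.+1 * n.+2) %/ 2 = n.+1 + (n * n.+1) %/ 2.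
Proof. by rewrite -divnMDl //; congr (_ %/ 2); lia. Qed.

Lemma cpair_up a b : cpair a b.+1 = (cpair a.+1 b).+1.
Proof. by rewrite !cpairE addnS addSn addnS. Qed.

Lemma cpair_next a : cpair a.+1 0 = (cpair 0 a).+1.
Proof. by rewrite !cpairE !addn0 add0n triangleS; lia. Qed.

(** Induction on the code: by [cpair_up] and [cpair_next], adding 1 to a code moves one place along
    the walk through the diagonals that [cunpair] performs. *)
Lemma cpairK a b : cunpair (cpair a b) = (a, b).
Proof.
move: {2}(cpair a b) (erefl (cpair a b)) => n.
elim: n a b => [|n IH] a [|b].
- by case: a => [|a] //; rewrite cpair_next.
- by rewrite cpair_up.
- case: a => [|a]; first by [].
  by rewrite cpair_next => -[] /[dup] /IH h e /=; rewrite h.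
- by rewrite cpair_up => -[] /IH h /=; rewrite h.
Qed.

(** A command is the whole remaining computation, so it doubles as a control state and takes the
    place of labels and a program counter. *)
Inductive cmd : Type :=
| Done
| Inc of nat & cmd
| Loop of nat & cmd & cmd.

Definition store := nat -> nat.

Definition upd (s : store) (r v : nat) : store := fun j => if j == r then v else s j.

Fixpoint seqc (c k : cmd) : cmd :=
  match c with
  | Done => k
  | Inc r c' => Inc r (seqc c' k)
  | Loop r b c' => Loop r b (seqc c' k)
  end.

Definition cstep (x : cmd * store) : cmd * store :=
  let: (c, s) := x in
  match c with
  | Done => x
  | Inc r k => (k, upd s r (s r).+1)
  | Loop r b k => if s r is m.+1 then (seqc b c, upd s r m) else (k, s)
  end.

(** Quantifying over the continuation [k] is what makes runs compose. *)
Definition runs (c : cmd) (s t : store) : Prop :=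
  forall k, exists n, iter n cstep (seqc c k, s) = (k, t).

Lemma seqcA c d k : seqc (seqc c d) k = seqc c (seqc d k).
Proof. by elim: c => [|r c IH|r b _ c IH] //=; rewrite IH. Qed.

Lemma runs_done s : runs Done s s.
Proof. by move=> k; exists 0. Qed.

Lemma runs_seq c d s t u : runs c s t -> runs d t u -> runs (seqc c d) s u.
Proof.
move=> rc rd k; have [n e] := rc (seqc d k); have [m e'] := rd k.
by exists (m + n); rewrite iterD seqcA e.
Qed.

Notation inc r := (Inc r Done).
Notation loop r b := (Loop r b Done).

Lemma runs_inc r s : runs (inc r) s (upd s r (s r).+1).
Proof. by move=> k; exists 1. Qed.

Lemma runs_loop0 r b s : s r = 0 -> runs (loop r b) s s.
Proof. by move=> e k; exists 1; rewrite /= e. Qed.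

Lemma runs_loopS r b m s t u : s r = m.+1 -> runs b (upd s r m) t ->
  runs (loop r b) t u -> runs (loop r b) s u.
Proof.
move=> e rb rl k; have [n1 e1] := rb (Loop r b k); have [n2 e2] := rl k.
by exists (n2 + n1.+1); rewrite iterD iterSr /= e e1.
Qed.

(** [F i] is the store when [i] rounds remain; the test has already decremented [r] when the body
    starts, hence [upd (F i.+1) r i]. *)
Lemma runs_for r b (F : nat -> store) n :
  (forall i, i < n -> runs b (upd (F i.+1) r i) (F i)) ->
  (forall i, i <= n -> F i r = i) -> runs (loop r b) (F n) (F 0).
Proof.
elim: n => [|n IH] hb hF; first by apply: runs_loop0; rewrite hF.
apply: (@runs_loopS _ _ n _ (F n)); first by rewrite hF.
  exact: hb.
by apply: IH => i hi; [apply: hb|apply: hF]; apply: ltnW.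
Qed.

Lemma runs_eq c s s' t t' : runs c s t -> s = s' -> t = t' -> runs c s' t'.
Proof. by move=> h <- <-. Qed.

Ltac decide_regs :=
  repeat match goal with
  | |- context [if ?x == ?y then _ else _] =>
      first [ rewrite (_ : (x == y) = false); last by lia
            | rewrite (_ : (x == y) = true); last by lia
            | case: (@eqP _ x y) => ?; subst ]
  end.
Ltac store_eq := let j := fresh "j" in apply: funext => j; rewrite /upd; decide_regs.

Definition clear r := loop r Done.

Lemma runs_clear r s : runs (clear r) s (upd s r 0).
Proof.
apply: (runs_eq (@runs_for r Done (fun i => upd s r i) (s r) _ _)).
- by move=> i _; apply: (runs_eq (runs_done _)); [reflexivity|store_eq].
- by move=> i _; rewrite /upd eqxx.
- by store_eq.
- by [].
Qed.

Definition move r r' := loop r (inc r').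

Lemma runs_move r r' s : r != r' ->
  runs (move r r') s (upd (upd s r' (s r' + s r)) r 0).
Proof.
move=> d.
apply: (runs_eq (@runs_for r (inc r')
  (fun i => upd (upd s r' (s r' + (s r - i))) r i) (s r) _ _)).
- move=> i hi; apply: (runs_eq (runs_inc _ _)); first reflexivity.
  by store_eq => //; lia.
- by move=> i _; rewrite /upd eqxx.
- by store_eq => //; lia.
- by store_eq => //; lia.
Qed.

Definition copy r r' t := seqc (loop r (Inc r' (inc t))) (move t r).

Lemma runs_copy r r' t s : r != r' -> r != t -> r' != t -> s t = 0 ->
  runs (copy r r' t) s (upd s r' (s r' + s r)).
Proof.
move=> d d1 d2 e; rewrite /copy.
apply: (@runs_seq _ _ _ (upd (upd (upd s r' (s r' + s r)) t (s r)) r 0)).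
  apply: (runs_eq (@runs_for r (Inc r' (inc t))
    (fun i => upd (upd (upd s r' (s r' + (s r - i))) t (s r - i)) r i) (s r) _ _)).
  - move=> i hi; apply: (runs_eq (runs_seq (runs_inc _ _) (runs_inc _ _))); first reflexivity.
    by store_eq => //; lia.
  - by move=> i _; rewrite /upd eqxx.
  - by store_eq => //; lia.
  - by store_eq => //; lia.
apply: (runs_eq (@runs_move t r _ _)); first by lia.
  by [].
by store_eq => //; lia.
Qed.

Lemma runs_to c s t t' : runs c s t -> t = t' -> runs c s t'.
Proof. by move=> h <-. Qed.

Ltac reg_eq := rewrite /upd; decide_regs; lia.
Ltac run lem := eapply runs_seq; [apply: lem; try by reg_eq|].

Arguments seqc : simpl never.

(** Loops act as conditionals. The flag [f] is set; the loop on [a] runs at most once, since its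
    body parks the rest of [a] in [g], and it clears [f]. So the last loop runs, once, exactly when
    [a] was 0. *)
Definition unpair_step (a b f g : nat) : cmd :=
  seqc (inc f)
    (seqc (loop a (seqc (clear f) (seqc (inc b) (move a g))))
       (seqc (move g a) (loop f (seqc (inc a) (move b a))))).

Lemma runs_unpair_step a b f g s : uniq [:: a; b; f; g] ->
  s f = 0 -> s g = 0 ->
  runs (unpair_step a b f g) s
    (if s a is m.+1 then upd (upd s a m) b (s b).+1
     else upd (upd s a (s b).+1) b 0).
Proof.
rewrite /= !inE => u sf sg; case sa : (s a) => [|m].
- eapply runs_to.
    run runs_inc; run runs_loop0; run runs_move.
    apply: (@runs_loopS _ _ 0); first by reg_eq.
      by run runs_inc; apply: runs_move; lia.
    by apply: runs_loop0; reg_eq.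
  by store_eq; lia.
- eapply runs_to.
    run runs_inc.
    eapply runs_seq.
      apply: (@runs_loopS _ _ m); first by reg_eq.
        by run runs_clear; run runs_inc; apply: runs_move; lia.
      by apply: runs_loop0; reg_eq.
    run runs_move.
    by apply: runs_loop0; reg_eq.
  by store_eq; lia.
Qed.

Definition unpair b := loop b (unpair_step (b + 1) (b + 2) (b + 3) (b + 4)).

Definition clean b (s : store) := forall j, b < j -> s j = 0.

Ltac use_clean H :=
  lazymatch type of H with clean _ ?s =>
    repeat match goal with |- context [s ?x] => rewrite (H x); last by lia end
  end.

Ltac clean_eq H := let j := fresh "j" in let hj := fresh "hj" in
  move=> j hj; rewrite /upd; decide_regs; use_clean H; lia.

Ltac reg_eq_clean H := rewrite /upd; decide_regs; use_clean H; lia.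

Lemma runs_unpair b s : clean b s ->
  runs (unpair b) s
    (upd (upd (upd s b 0) (b + 1) (cunpair (s b)).1) (b + 2) (cunpair (s b)).2).
Proof.
move=> cl.
pose F i := upd (upd (upd s b i) (b + 1) (cunpair (s b - i)).1) (b + 2) (cunpair (s b - i)).2.
apply: (runs_eq (@runs_for b _ F (s b) _ _)); last first.
- by rewrite /F subn0.
- by rewrite /F subnn /=; store_eq; use_clean cl; lia.
- by move=> i _; rewrite /F; reg_eq.
move=> i hi; rewrite /F (_ : s b - i = (s b - i.+1).+1) /=; last by lia.
case e: (cunpair (s b - i.+1)) => [x y] /=.
eapply runs_to.
  apply: runs_unpair_step; first by rewrite /= !inE; lia.
  by reg_eq_clean cl.
  by reg_eq_clean cl.
rewrite (_ : upd _ _ _ (b + 1) = x); last by reg_eq.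
by case: x e => [|x] e /=; store_eq; use_clean cl; lia.
Qed.

(** Obtains the triangular number without division, as a sum of decreasing terms: after the
    decrement each round adds 1 plus what is left in [b + 1]. *)
Definition pair_loop b :=
  loop (b + 1) (seqc (inc b) (copy (b + 1) b (b + 2))).

Lemma runs_pair_loop b n s : s (b + 1) = n -> s (b + 2) = 0 ->
  runs (pair_loop b) s (upd (upd s b (s b + (n * n.+1) %/ 2)) (b + 1) 0).
Proof.
elim: n s => [|n IH] s s1 s2.
  eapply runs_to; first by apply: runs_loop0.
  by store_eq; lia.
eapply runs_to.
  apply: (@runs_loopS _ _ n); first exact: s1.
    run runs_inc; apply: runs_copy; try lia; by reg_eq.
  by apply: IH; reg_eq.
by rewrite triangleS; store_eq; lia.
Qed.

Definition pairc b :=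
  seqc (copy (b + 2) b (b + 3)) (seqc (move (b + 2) (b + 1)) (pair_loop b)).

Lemma runs_pairc b s : s b = 0 -> s (b + 3) = 0 ->
  runs (pairc b) s
    (upd (upd (upd s b (cpair (s (b + 1)) (s (b + 2)))) (b + 1) 0) (b + 2) 0).
Proof.
move=> s0 s3.
eapply runs_to.
  eapply runs_seq; first by apply: runs_copy; try lia.
  run runs_move.
  by apply: runs_pair_loop; [reflexivity|reg_eq].
rewrite (_ : upd _ (b + 2) 0 (b + 1) = s (b + 1) + s (b + 2)); last by reg_eq.
by rewrite cpairE; store_eq; lia.
Qed.

Notation "c ;; d" := (seqc c d) (at level 60, right associativity).

(* Input and result of [compile p b] are in register [b]; the registers above [b]
   are scratch space, assumed to be 0 and reset to 0, those below are kept. *)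
Fixpoint compile (p : prog) (b : nat) : cmd :=
  match p with
  | PZero => clear b
  | PSucc => inc b
  | PId => Done
  | PFst => unpair b ;; clear (b + 2) ;; move (b + 1) b
  | PSnd => unpair b ;; clear (b + 1) ;; move (b + 2) b
  | PPair f g =>
      copy b (b + 1) (b + 2) ;; compile f (b + 1) ;;
      move b (b + 2) ;; compile g (b + 2) ;; pairc b
  | PComp f g => compile g b ;; compile f b
  | PRec f g =>
      unpair b ;; copy (b + 2) (b + 3) (b + 4) ;; compile f (b + 3) ;;
      loop (b + 1)
        (move (b + 3) (b + 7) ;; copy (b + 2) (b + 8) (b + 9) ;; pairc (b + 6) ;;
         copy b (b + 5) (b + 7) ;; pairc (b + 4) ;; compile g (b + 4) ;;
         move (b + 4) (b + 3) ;; inc b) ;;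
      clear b ;; clear (b + 2) ;; move (b + 3) b
  | PMu f =>
      inc (b + 2) ;;
      loop (b + 2)
        (copy (b + 1) (b + 4) (b + 6) ;; copy b (b + 5) (b + 6) ;;
         pairc (b + 3) ;; compile f (b + 3) ;;
         loop (b + 3) (clear (b + 3) ;; inc (b + 1) ;; inc (b + 2))) ;;
      clear b ;; move (b + 1) b
  end.

(** The sequence [ys] of intermediate values is what the loop invariant of a compiled [PRec] is
    built from. *)
Lemma eval_recE f g n x y : eval (PRec f g) (cpair n x) y ->
  exists ys : nat -> nat, [/\ eval f x (ys 0),
    forall i, i < n -> eval g (cpair i (cpair (ys i) x)) (ys i.+1) & ys n = y].
Proof.
move ep: (PRec f g) => p; move ez: (cpair n x) => z ev.
elim: ev f g n x ep ez => // {p z y}.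
  move=> f' g' x' y ev _ f g n x [-> _] /(congr1 cunpair); rewrite !cpairK => -[-> ->].
  by exists (fun=> y).
move=> f' g' n' x' y z ev IH evg _ f g n x [-> ->].
move=> /(congr1 cunpair); rewrite !cpairK => -[-> ->] {f g n x}.
have [ys [h0 hS hn]] := IH _ _ _ _ erefl erefl.
exists (fun i => if i <= n' then ys i else z); split => //; last by rewrite ltnn.
move=> i; rewrite ltnS => hi; rewrite hi; case: ltnP => h; first exact: hS.
by rewrite (_ : i = n') ?hn //; lia.
Qed.

Lemma runs_compile p x y : eval p x y -> forall b s, clean b s -> s b = x ->
  runs (compile p b) s (upd s b y).
Proof.
elim: p x y => [||||| f IHf g IHg | f IHf g IHg | f IHf g IHg | f IHf] x y ev b s cl e /=.
- by inversion ev; apply: runs_clear.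
- by inversion ev; subst; apply: runs_inc.
- by inversion ev; subst; apply: (runs_to (runs_done _)); store_eq.
- inversion ev; subst; eapply runs_to.
    eapply runs_seq; first exact: runs_unpair.
    by run runs_clear; apply: runs_move; lia.
  by store_eq; use_clean cl; lia.
- inversion ev; subst; eapply runs_to.
    eapply runs_seq; first exact: runs_unpair.
    by run runs_clear; apply: runs_move; lia.
  by store_eq; use_clean cl; lia.
- inversion ev as [| | | | |? ? ? a c ef eg| | | |]; subst; eapply runs_to.
    eapply runs_seq; first by apply: runs_copy; try lia; reg_eq_clean cl.
    eapply runs_seq; first by apply: (IHf _ _ ef); [clean_eq cl|reg_eq_clean cl].
    run runs_move.
    eapply runs_seq; first by apply: (IHg _ _ eg); [clean_eq cl|reg_eq_clean cl].
    by apply: runs_pairc; reg_eq_clean cl.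
  rewrite (_ : upd _ (b + 2) c (b + 1) = a); last by reg_eq.
  rewrite (_ : upd _ (b + 2) c (b + 2) = c); last by reg_eq.
  by store_eq; use_clean cl; lia.
- inversion ev as [| | | | | |? ? ? z ? eg ef| | |]; subst; eapply runs_to.
    eapply runs_seq; first exact: (IHg _ _ eg).
    by apply: (IHf _ _ ef); [clean_eq cl|reg_eq].
  by store_eq.
- have [n [x0 ex]] : exists n x0, x = cpair n x0.
    by inversion ev; subst; do 2!eexists.
  rewrite ex in ev e => {x ex}; have [ys [h0 hS hn]] := eval_recE ev.
  (* With [i] rounds left: rounds done in [b], rounds left in [b + 1], the parameter in [b + 2], the
     current value in [b + 3]. *)
  pose F i := upd (upd (upd (upd s b (n - i)) (b + 1) i) (b + 2) x0) (b + 3) (ys (n - i)).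
  eapply runs_to.
    eapply runs_seq; first exact: runs_unpair.
    rewrite e cpairK /=.
    eapply runs_seq; first by apply: runs_copy; try lia; reg_eq_clean cl.
    eapply runs_seq; first by apply: (IHf _ _ h0); [clean_eq cl|reg_eq_clean cl].
    eapply runs_seq.
      apply: (runs_eq (@runs_for _ _ F n _ _)); last reflexivity.
      - move=> i hi; rewrite /F (_ : n - i = (n - i.+1).+1); last by lia.
        have := hS (n - i.+1); move: (ys _) (ys _) => y1 y2 {}hS.
        eapply runs_to.
          run runs_move.
          eapply runs_seq; first by apply: runs_copy; try lia; reg_eq_clean cl.
          eapply runs_seq; first by apply: runs_pairc; reg_eq_clean cl.
          eapply runs_seq; first by apply: runs_copy; try lia; reg_eq_clean cl.
          eapply runs_seq; first by apply: runs_pairc; reg_eq_clean cl.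
          eapply runs_seq.
            apply: IHg; first by apply: hS; lia.
              by clean_eq cl.
            by rewrite /upd; decide_regs; use_clean cl; do ?congr cpair; lia.
          run runs_move.
          by apply: runs_inc.
        by store_eq; use_clean cl; lia.
      - by move=> i hi; rewrite /F; reg_eq.
      - by rewrite /F subnn; store_eq; use_clean cl; lia.
    run runs_clear; run runs_clear; apply: runs_move; lia.
  by rewrite /F subn0 hn; store_eq; use_clean cl; lia.
- inversion ev as [| | | | | | | | |? ? n ev0 evS]; subst.
  (* The candidate [m] in [b + 1] is [d] below the answer, and [b + 2] is a flag requesting a round.
     The inner loop runs at most once, as it clears its own counter; it moves to the next candidate
     and sets the flag again when the value at [m] is nonzero. *)
  have rl m d : m + d = y ->
      runs (loop (b + 2)
        (copy (b + 1) (b + 4) (b + 6) ;; copy b (b + 5) (b + 6) ;;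
         pairc (b + 3) ;; compile f (b + 3) ;;
         loop (b + 3) (clear (b + 3) ;; inc (b + 1) ;; inc (b + 2))))
      (upd (upd s (b + 1) m) (b + 2) 1) (upd s (b + 1) y).
    elim: d m => [|d IH] m hm.
      apply: runs_loopS; [by rewrite /upd eqxx| |].
        eapply runs_seq; first by apply: runs_copy; try lia; reg_eq_clean cl.
        eapply runs_seq; first by apply: runs_copy; try lia; reg_eq_clean cl.
        eapply runs_seq; first by apply: runs_pairc; reg_eq_clean cl.
        eapply runs_seq.
          by apply: (IHf _ _ ev0); [clean_eq cl|rewrite /upd; decide_regs; use_clean cl; do ?congr cpair; lia].
        by apply: runs_loop0; reg_eq.
      eapply runs_to; first by apply: runs_loop0; reg_eq.
      by store_eq; use_clean cl; lia.
    have [k evk] : exists k, eval f (cpair m (s b)) k.+1 by apply: evS; lia.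
    apply: runs_loopS; [by rewrite /upd eqxx| |].
      eapply runs_seq; first by apply: runs_copy; try lia; reg_eq_clean cl.
      eapply runs_seq; first by apply: runs_copy; try lia; reg_eq_clean cl.
      eapply runs_seq; first by apply: runs_pairc; reg_eq_clean cl.
      eapply runs_seq.
        by apply: (IHf _ _ evk); [clean_eq cl|rewrite /upd; decide_regs; use_clean cl; do ?congr cpair; lia].
      apply: (@runs_loopS _ _ k); first by reg_eq.
        run runs_clear; run runs_inc; exact: runs_inc.
      by apply: runs_loop0; reg_eq.
    apply: (runs_eq (IH m.+1 _)); last by [].
      lia.
    by store_eq; use_clean cl; lia.
  eapply runs_to.
    run runs_inc.
    eapply runs_seq.
      apply: (runs_eq (rl 0 y erefl)); last reflexivity.
      by store_eq; use_clean cl; lia.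
    run runs_clear; apply: runs_move; lia.
  by store_eq; use_clean cl; lia.
Qed.

(** * Finiteness of control states and registers *)

Lemma cmd_eq_dec (c d : cmd) : decidable (c = d).
Proof. by rewrite /decidable; decide equality; apply: eq_comparable. Qed.

HB.instance Definition _ := hasDecEq.Build cmd (compareP cmd_eq_dec).

(** Control states are continuations, so a finite list of them closed under [succs] has to be
    exhibited before they can serve as letters. The final [k] itself is left out. *)
Fixpoint controls_in (c k : cmd) : seq cmd :=
  match c with
  | Done => [::]
  | Inc r c' => (c ;; k) :: controls_in c' k
  | Loop r b c' =>
      (c ;; k) :: controls_in b (c ;; k) ++ controls_in c' k
  end.

Definition controls c := Done :: controls_in c Done.

Definition succs (c : cmd) : seq cmd :=
  match c with
  | Done => [::]
  | Inc _ k => [:: k]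
  | Loop _ b k => [:: k; b ;; c]
  end.

Lemma mem_controls_in c k : (c ;; k) \in k :: controls_in c k.
Proof. by case: c => *; rewrite !inE eqxx ?orbT. Qed.

Lemma controls_in_closed c k d : d \in controls_in c k ->
  {subset succs d <= k :: controls_in c k}.
Proof.
elim: c k => [|r c IH|r b IHb c IHc] k //=; rewrite inE => /orP[/eqP->|].
- move=> x; rewrite /= inE => /eqP ->.
  by have := mem_controls_in c k; rewrite !inE => /orP[->|->]; rewrite ?orbT.
- by move=> /IH h x /h; rewrite !inE => /orP[->|->]; rewrite ?orbT.
- move=> x; rewrite /= !inE => /orP[] /eqP ->.
    by have := mem_controls_in c k; rewrite !inE mem_cat => /orP[->|->]; rewrite ?orbT.
  have := mem_controls_in b (Loop r b c ;; k).
  by rewrite !inE mem_cat => /orP[->|->]; rewrite ?orbT.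
rewrite mem_cat => /orP[/IHb|/IHc] h x /h; rewrite !inE mem_cat.
  by move=> /orP[->|->]; rewrite ?orbT.
by move=> /orP[->|->]; rewrite ?orbT.
Qed.

Lemma controls_closed c d : d \in controls c -> {subset succs d <= controls c}.
Proof.
by rewrite inE => /orP[/eqP->|/controls_in_closed].
Qed.

Lemma seqc_Done c : (c ;; Done) = c.
Proof. by elim: c => [|r c IH|r b _ c IH] //; rewrite -{2}IH. Qed.

Lemma mem_controls c : c \in controls c.
Proof. by have := mem_controls_in c Done; rewrite seqc_Done. Qed.

Fixpoint regs_below (m : nat) (c : cmd) : bool :=
  match c with
  | Done => true
  | Inc r k => (r < m) && regs_below m k
  | Loop r b k => [&& r < m, regs_below m b & regs_below m k]
  end.

Lemma regs_below_mono m n c : m <= n -> regs_below m c -> regs_below n c.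
Proof.
move=> mn; elim: c => [|r c IH|r b IHb c IHc] //=.
  by move=> /andP[h /IH ->]; rewrite (leq_trans h mn).
by move=> /and3P[h /IHb -> /IHc ->]; rewrite (leq_trans h mn).
Qed.

(** The bound is a successor so that register 0, which holds the input, is always among the encoded
    registers. *)
Lemma regs_below_exists c : exists m, regs_below m.+1 c.
Proof.
elim: c => [|r c [m IH]|r b [m IHb] c [n IHc]]; first by exists 0.
  by exists (r + m); rewrite /= (@regs_below_mono m.+1) //; lia.
exists (r + m + n); rewrite /= (@regs_below_mono m.+1 _ b) //; last by lia.
by rewrite (@regs_below_mono n.+1 _ c) //; lia.
Qed.

Lemma regs_below_seqc m c k : regs_below m (c ;; k) = regs_below m c && regs_below m k.
Proof.
by elim: c => [|r c IH|r b _ c IH] //; rewrite [seqc _ _]/= /= IH !andbA.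
Qed.

Lemma regs_below_controls_in m c k : regs_below m c -> regs_below m k ->
  all (regs_below m) (controls_in c k).
Proof.
elim: c k => [|r c IH|r b IHb c IHc] k //=.
  by move=> /andP[h hc] hk; rewrite regs_below_seqc /= h hc hk IH.
move=> /and3P[h hb hc] hk; rewrite all_cat regs_below_seqc /= h hb hc hk IHc // IHb //.
by rewrite regs_below_seqc /= h hb hc.
Qed.

Lemma regs_below_controls m c : regs_below m c -> all (regs_below m) (controls c).
Proof. by move=> h; rewrite /= regs_below_controls_in. Qed.

(** * The diagonal machine *)

Definition input (x : nat) : store := upd (fun=> 0) 0 x.

(* The final loop runs forever unless register 0 holds 0. *)
Definition diag_cmd (p : prog) : cmd := compile p 0 ;; loop 0 (inc 0).

Lemma diag_reach p x y : eval p x y ->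
  exists n, iter n cstep (diag_cmd p, input x) = (loop 0 (inc 0), input y).
Proof.
move=> ev.
have cl : clean 0 (input x) by move=> [|j].
have [n e] := runs_compile ev cl erefl (loop 0 (inc 0)).
by exists n; rewrite /diag_cmd e; congr (_, _); rewrite /input; store_eq.
Qed.

Definition halts (c : cmd) (s : store) := exists n, (iter n cstep (c, s)).1 = Done.

Lemma diag_halts p x : eval p x 0 -> halts (diag_cmd p) (input x).
Proof. by move=> /diag_reach[n e]; exists n.+1; rewrite iterS e. Qed.

Lemma iter_cstep_Done n s : iter n cstep (Done, s) = (Done, s).
Proof. by elim: n => //= n ->. Qed.

Lemma diag_diverges p x : eval p x 1 -> ~ halts (diag_cmd p) (input x).
Proof.
move=> /diag_reach[n e] [m hm].
have cyc i : iter i.*2 cstep (loop 0 (inc 0), input 1) = (loop 0 (inc 0), input 1).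
  elim: i => // i IH; rewrite doubleS 2!iterSr /=.
  by rewrite -[RHS]IH; congr (iter _ _ (_, _)); store_eq.
(* From step [n] on the run has period 2, so it is at the loop after [m.*2 + n] steps; but it has
   been at [Done] since step [m]. *)
have := cyc m; rewrite -{1}e -iterD (_ : m.*2 + n = m + n + m); last by lia.
by rewrite iterD; case: (iter m _ _) hm => c s /= ->; rewrite iter_cstep_Done.
Qed.

(** * Values of formulas *)

Import Order.TTheory GRing.Theory Num.Theory.

Notation tail := Defs.suffix.

Section Semantics.
Local Open Scope ring_scope.

Lemma le_sup_range (F : nat -> RR) i : (forall j, F j <= 1) ->
  F i <= sup [set F j | j in [set: nat]].
Proof.
move=> h; apply: ub_le_sup; last by exists i.
by exists 1 => _ [j _ <-].
Qed.

Lemma sup_range_le (F : nat -> RR) b : (forall j, F j <= b) ->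
  sup [set F j | j in [set: nat]] <= b.
Proof.
move=> h; apply: ge_sup; first by exists (F 0%N), 0%N.
by move=> _ [j _ <-].
Qed.

(** The clause [b <= 1] accounts for the empty minimum, which is 1. *)
Lemma le_fmin (b : RR) n F : b <= fmin n F <-> b <= 1 /\ forall j, (j < n)%N -> b <= F j.
Proof.
rewrite /fmin; elim: n F => [|n IH] F; first by rewrite big_ord0; split=> [|[]].
have {}IH := IH (fun j => F j.+1); rewrite big_ord_recl /= le_min; split.
  by move=> /andP[h0 /IH[h1 h]]; split=> // -[|j] // /h.
by move=> [h1 h]; rewrite h //=; apply/IH; split => // j hj; apply: h.
Qed.

Lemma tail_tail pi i j : tail (tail pi i) j = tail pi (i + j).
Proof. by apply: funext => k; rewrite /tail addnA. Qed.

Lemma tail0 pi : tail pi 0 = pi.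
Proof. by []. Qed.

Variable delta : nat -> nat -> RR.
Hypothesis delta_disc : forall e, discounting (delta e).

Lemma delta_ge0 e i : 0 <= delta e i.
Proof. by have [/(_ i)/andP[]] := delta_disc e. Qed.

Lemma delta_le1 e i : delta e i <= 1.
Proof. by have [/(_ i)/andP[]] := delta_disc e. Qed.

Lemma delta_lt e i j : (i < j)%N -> delta e j < delta e i.
Proof. by have [_ [h _]] := delta_disc e; apply: h. Qed.

Lemma delta_le e i j : (i <= j)%N -> delta e j <= delta e i.
Proof. by rewrite leq_eqVlt => /orP[/eqP->//|/delta_lt/ltW]. Qed.

Lemma sem_bounds f pi : 0 <= sem delta f pi <= 1.
Proof.
elim: f pi => [|p|f IH|f IHf g IHg|f IH|f IHf g IHg|e f IHf g IHg|f IHf g IHg] pi /=.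
- by rewrite ler01 lexx.
- by case: ifP; rewrite ?ler01 ?lexx.
- by have /andP[] := IH pi; lra.
- by have /andP[h1 h2] := IHf pi; have /andP[h3 h4] := IHg pi; rewrite le_max ge_max h1 h2 h4.
- exact: IH.
- apply/andP; split; last first.
    by apply: sup_range_le => j; rewrite ge_min; have /andP[_ ->] := IHg (tail pi j).
  apply: le_trans (le_sup_range (F := fun i => Num.min (sem delta g (tail pi i)) (fmin i (fun j => sem delta f (tail pi j)))) 0%N _).
    rewrite le_min; have /andP[-> _] := IHg (tail pi 0); apply/le_fmin; split => //.
  by move=> j; rewrite ge_min; have /andP[_ ->] := IHg (tail pi j).
- have b i : delta e i * sem delta g (tail pi i) <= 1.
    by have /andP[h1 h2] := IHg (tail pi i); rewrite mulr_ile1 ?delta_ge0 ?delta_le1.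
  apply/andP; split; last by apply: sup_range_le => j; rewrite ge_min b.
  apply: le_trans (le_sup_range (F := fun i => Num.min (delta e i * sem delta g (tail pi i)) (fmin i (fun j => delta e j * sem delta f (tail pi j)))) 0%N _).
    rewrite le_min; have /andP[h _] := IHg (tail pi 0); rewrite mulr_ge0 ?delta_ge0 //=.
    by apply/le_fmin; split.
  by move=> j; rewrite ge_min b.
- by have /andP[h1 h2] := IHf pi; have /andP[h3 h4] := IHg pi; lra.
Qed.

Lemma sem_ge0 f pi : 0 <= sem delta f pi.
Proof. by have /andP[] := sem_bounds f pi. Qed.

Lemma sem_le1 f pi : sem delta f pi <= 1.
Proof. by have /andP[] := sem_bounds f pi. Qed.

Lemma sem_next f pi : sem delta (FNext f) pi = sem delta f (tail pi 1).
Proof. by []. Qed.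

Lemma sem_neg f pi : sem delta (FNeg f) pi = 1 - sem delta f pi.
Proof. by []. Qed.

Lemma sem_or f g pi : sem delta (FOr f g) pi = Num.max (sem delta f pi) (sem delta g pi).
Proof. by []. Qed.

Lemma sem_until_le f g pi b :
  (forall i, Num.min (sem delta g (tail pi i)) (fmin i (fun j => sem delta f (tail pi j))) <= b) ->
  sem delta (FUntil f g) pi <= b.
Proof. exact: sup_range_le. Qed.

Lemma sem_until_ge f g pi i :
  Num.min (sem delta g (tail pi i)) (fmin i (fun j => sem delta f (tail pi j))) <=
  sem delta (FUntil f g) pi.
Proof.
by apply: (le_sup_range (F := fun i => Num.min _ (fmin i _))) => j; rewrite ge_min sem_le1.
Qed.

Definition FAnd f g := FNeg (FOr (FNeg f) (FNeg g)).

Lemma sem_and f g pi : sem delta (FAnd f g) pi = Num.min (sem delta f pi) (sem delta g pi).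
Proof.
rewrite /=; set x := sem _ _ _; set y := sem _ _ _.
by case: (leP (1 - x) (1 - y)); case: (leP x y); lra.
Qed.

Definition FEventually f := FUntil FTrue f.

Lemma sem_eventually_ge f pi i : sem delta f (tail pi i) <= sem delta (FEventually f) pi.
Proof.
apply: le_trans (sem_until_ge _ _ _ i).
by rewrite le_min lexx; apply/le_fmin; split=> *; apply: sem_le1.
Qed.

Lemma sem_eventually_le f pi b : (forall i, sem delta f (tail pi i) <= b) ->
  sem delta (FEventually f) pi <= b.
Proof. by move=> h; apply: sem_until_le => i; rewrite ge_min h. Qed.

(** * Measuring and comparing distances *)

Definition first (a : nat) (pi : computation) (n : nat) :=
  a \in pi n /\ forall j, (j < n)%N -> a \notin pi j.

Lemma firstP a pi : (exists n, first a pi n) \/ forall j, a \notin pi j.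
Proof.
have [[n hn]|h] := pselect (exists n, a \in pi n); last first.
  by right=> j; apply/negP => hj; apply: h; exists j.
left; have ex : exists n, a \in pi n by exists n.
case: (ex_minnP ex) => m hm mmin; exists m; split=> // j jm.
by apply/negP => /mmin; rewrite leqNgt jm.
Qed.

Definition FDist a := FDUntil 0 FTrue (FAtom a).

Lemma sem_atom a pi : sem delta (FAtom a) pi = (a \in pi 0%N)%:R.
Proof. by rewrite /=; case: ifP. Qed.

(** Positions before [n] contribute 0 and, [delta 0] being decreasing, those after [n] at most
    [delta 0 n]; monotonicity also makes the discounted [FTrue] on the left harmless. *)
Lemma sem_dist_first a pi n : first a pi n -> sem delta (FDist a) pi = delta 0 n.
Proof.
move=> [an hn]; apply/eqP; rewrite eq_le; apply/andP; split.
  apply: sup_range_le => i; rewrite /= ge_min /tail addn0.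
  have [ni|/hn] := leqP n i; last by move=> /negbTE ->; rewrite mulr0 delta_ge0.
  by apply/orP; left; case: ifP => _; rewrite ?mulr1 ?mulr0 ?delta_ge0 ?delta_le.
apply: le_trans (le_sup_range (F := fun i => Num.min (delta 0 i * sem delta (FAtom a) (tail pi i)) (fmin i (fun j => delta 0 j * sem delta FTrue (tail pi j)))) n _).
  rewrite le_min sem_atom /tail addn0 an mulr1 lexx; apply/le_fmin; split; first exact: delta_le1.
  by move=> j /ltnW jn; rewrite mulr1 delta_le.
by move=> j; rewrite ge_min mulr_ile1 ?delta_ge0 ?sem_ge0 ?delta_le1 ?sem_le1.
Qed.

Lemma sem_dist_never a pi : (forall j, a \notin pi j) -> sem delta (FDist a) pi = 0.
Proof.
move=> h; apply/eqP; rewrite eq_le sem_ge0 andbT.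
by apply: sup_range_le => i; rewrite ge_min /= /tail addn0 (negbTE (h _)) mulr0 lexx.
Qed.

Definition FNextMark k f := FNext (FUntil (FNeg (FAtom k)) (FAnd (FAtom k) f)).

(** The mark is two-valued, so only position [n] can contribute: before it the right argument is 0,
    after it the minimum includes the value 0 of [FNeg (FAtom k)] at [n]. *)
Lemma sem_nextmark_first k f pi n : first k (tail pi 1) n ->
  sem delta (FNextMark k f) pi = sem delta f (tail pi n.+1).
Proof.
have tl i : tail (tail pi 1) i 0%N = tail pi 1 i by rewrite /tail addn0.
move=> [kn hn]; rewrite sem_next; apply/eqP; rewrite eq_le; apply/andP; split.
  apply: sem_until_le => i; rewrite ge_min sem_and ge_min sem_atom tl.
  case: (ltngtP i n) => [/hn/negbTE ->|ni|->]; first by rewrite sem_ge0.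
    apply/orP; right; set m := fmin _ _.
    have /le_fmin[_ /(_ _ ni)] := lexx m.
    by move=> /le_trans -> //; rewrite sem_neg sem_atom tl kn subrr sem_ge0.
  by rewrite tail_tail add1n lexx orbT.
apply: le_trans (sem_until_ge _ _ _ n).
rewrite sem_and !le_min sem_atom tl kn sem_le1 tail_tail add1n lexx /=.
apply/le_fmin; split=> [|j /hn/negbTE h]; first exact: sem_le1.
by rewrite tl h subr0 sem_le1.
Qed.

Lemma sem_nextmark_never k f pi : (forall j, k \notin tail pi 1 j) ->
  sem delta (FNextMark k f) pi = 0.
Proof.
move=> h; apply/eqP; rewrite eq_le sem_ge0 andbT sem_next.
apply: sem_until_le => i; rewrite ge_min sem_and ge_min sem_atom.
have -> : tail (tail pi 1) i 0%N = tail pi 1 i by rewrite /tail addn0.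
by rewrite (negbTE (h _)) lexx.
Qed.

Definition FNeq f g := FOr (FAvg f (FNeg g)) (FAvg g (FNeg f)).

Lemma sem_neq f g pi :
  sem delta (FNeq f g) pi = 1 / 2 + `|sem delta f pi - sem delta g pi| / 2.
Proof.
rewrite /=; set x := sem _ _ _; set y := sem _ _ _.
case: (leP ((x + (1 - y)) / 2) ((y + (1 - x)) / 2)) => h; case: (leP 0 (x - y)) => h';
  by rewrite ?(ger0_norm h') ?(ltr0_norm h'); lra.
Qed.

Definition FBigOr (l : seq ltl) := foldr FOr (FNeg FTrue) l.

Lemma sem_bigor_map_le (T : eqType) (F : T -> ltl) (l : seq T) pi b : 0 <= b ->
  (forall x, x \in l -> sem delta (F x) pi <= b) -> sem delta (FBigOr (map F l)) pi <= b.
Proof.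
move=> b0; elim: l => [|x l IH] h /=; first by rewrite subrr.
rewrite ge_max h ?inE ?eqxx //= IH // => y hy; apply: h; by rewrite inE hy orbT.
Qed.

Lemma sem_bigor_map_ge (T : eqType) (F : T -> ltl) (l : seq T) pi x : x \in l ->
  sem delta (F x) pi <= sem delta (FBigOr (map F l)) pi.
Proof.
elim: l => //= y l IH; rewrite inE => /orP[/eqP->|/IH h]; rewrite le_max ?lexx //.
by rewrite h orbT.
Qed.

(** Take the least difference of consecutive values up to [n]; monotonicity extends it to every [j],
    however large. The clause [e <= delta 0 i] separates [delta 0 i] from 0, the value of [FDist]
    for an atom that never occurs. *)
Lemma delta_gap n : exists2 e : RR, 0 < e & forall i, (i <= n)%N ->
  e <= delta 0 i /\ forall j, j != i -> e <= `|delta 0 i - delta 0 j|.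
Proof.
have [e e0 he] : exists2 e : RR, 0 < e &
    forall i, (i <= n)%N -> e <= delta 0 i - delta 0 i.+1.
  elim: n => [|n [e e0 he]].
    exists (delta 0 0%N - delta 0 1%N); first by rewrite subr_gt0 delta_lt.
    by move=> i; rewrite leqn0 => /eqP ->.
  exists (Num.min e (delta 0 n.+1 - delta 0 n.+2)).
    by rewrite lt_min e0 subr_gt0 delta_lt.
  move=> i; rewrite leq_eqVlt ge_min => /orP[/eqP ->|/he ->//].
  by rewrite lexx orbT.
exists e => // i hi; split.
  by have := he i hi; have := delta_ge0 0 i.+1; lra.
move=> j; rewrite neq_ltn => /orP[ji|ij].
  have := he j (ltnW (leq_trans ji hi)); have := delta_le 0 ji; have := ler_norm (delta 0 j - delta 0 i).
  by rewrite distrC; lra.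
have := he i hi; have := delta_le 0 ij; have := ler_norm (delta 0 i - delta 0 j); lra.
Qed.
End Semantics.

(** * The reduction *)

Section Reduction.
Local Open Scope ring_scope.
Variables (k : nat) (cs : seq cmd).

(** Atoms below [k] stand for registers, [k] marks the opening letter of a configuration, and atoms
    above [k] name control states. *)
Definition FState c := FAtom (k.+1 + index c cs).
(** A register's value is a distance from the position after the opening letter, so at the opening
    letter itself [FDist i] measures one more. Dropping one of the two inner [FNext] therefore
    shifts the comparison by 1, which gives [FUp] and [FDown]. *)
Definition FKeep i := FNeq (FNext (FDist i)) (FNextMark k (FNext (FDist i))).
Definition FUp i := FNeq (FDist i) (FNextMark k (FNext (FDist i))).
Definition FDown i := FNeq (FNext (FDist i)) (FNextMark k (FDist i)).

Definition FBadStep c (F : nat -> ltl) :=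
  FOr (FNeg (FNextMark k (FState c))) (FBigOr [seq F i | i <- iota 0 k]).

(** In [Loop], the zero test asks whether the atom of [r] occurs right after the opening letter. *)
Definition FBadBody c :=
  match c with
  | Done => FTrue
  | Inc r d => FBadStep d (fun i => if i == r then FUp i else FKeep i)
  | Loop r b d =>
      FOr (FAnd (FNext (FAtom r)) (FBadStep d FKeep))
          (FAnd (FNeg (FNext (FAtom r)))
             (FBadStep (b ;; c) (fun i => if i == r then FDown i else FKeep i)))
  end.

Definition FBad c := FAnd (FState c) (FBadBody c).
Definition FBadRun := FEventually (FBigOr (map FBad cs)).

(** Two-valued: 0 if atom 0 first occurs at distance [n], and 1 otherwise. The recursion on [n] lets
    a program compute the code from [n]. *)
Fixpoint FNotInput n :=
  if n is m.+1 then FOr (FAtom 0) (FNext (FNotInput m)) else FNeg (FAtom 0).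

(** Collects all of the instance that is independent of the input, so that its code can be part of
    the input. *)
Definition FSpec c :=
  FOr (FOr (FNeg (FState c)) (FBigOr [seq FNeg (FNext (FAtom i)) | i <- iota 1 k.-1]))
      FBadRun.

Definition FInstance c n := FOr (FNext (FNotInput n)) (FSpec c).

(** Opening letters carry no register atom, so skipping one shifts first occurrences by exactly
    1. *)
Definition valid (pi : computation) := forall t a i,
  (k <= a)%N -> a \in pi t -> (i < k)%N -> i \notin pi t.

Definition at_config (pi : computation) (x : cmd * store) :=
  (k.+1 + index x.1 cs)%N \in pi 0%N /\ forall i, (i < k)%N -> first i (tail pi 1) (x.2 i).

Lemma valid_tail pi t : valid pi -> valid (tail pi t).
Proof. by move=> v u; apply: v. Qed.

Lemma first_succ a pi n : a \notin pi 0%N -> first a pi n.+1 <-> first a (tail pi 1) n.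
Proof.
move=> a0; rewrite /first /tail; split=> -[h1 h2]; split=> //.
  by move=> j hj; apply: h2.
by move=> [|j] // hj; apply: h2.
Qed.

Variable delta : nat -> nat -> RR.
Hypothesis delta_disc : forall e, discounting (delta e).

Lemma detect_dist e n a pi v :
  (forall i, (i <= n)%N ->
     e <= delta 0 i /\ forall j, j != i -> e <= `|delta 0 i - delta 0 j|) ->
  (v <= n)%N -> first a pi v \/ e <= `|delta 0 v - sem delta (FDist a) pi|.
Proof.
move=> gap vn; have [g0 gj] := gap v vn; have [[m fm]|nev] := firstP a pi.
  have [<-|mv] := eqVneq m v; [by left|right].
  by rewrite (sem_dist_first delta_disc fm) gj.
right; rewrite (sem_dist_never delta_disc nev) subr0 ger0_norm //.
by apply: delta_ge0.
Qed.

(** [v] is the value that register [i] should have in the next configuration, which starts at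
    [m.+1]. The upper bound serves diverging runs, the lower bound halting ones. *)
Definition detects e f i v pi m :=
  (first i (tail (tail pi m.+1) 1) v -> sem delta f pi <= 1 / 2) /\
  (first i (tail (tail pi m.+1) 1) v \/ 1 / 2 + e / 2 <= sem delta f pi).

Lemma detectsI (e : RR) f i v pi m (x y : RR) :
  sem delta f pi = 1 / 2 + `|x - y| / 2 ->
  (first i (tail (tail pi m.+1) 1) v -> x = y) ->
  (first i (tail (tail pi m.+1) 1) v \/ e <= `|x - y|) ->
  detects e f i v pi m.
Proof.
move=> eq_f h1 h2; rewrite /detects eq_f; split=> [/h1 ->|]; first by rewrite subrr normr0 mul0r addr0.
case: h2 => [h|h]; [by left|right].
by rewrite lerD2l ler_pM2r // invr_gt0.
Qed.

Section Step.
Variables (e : RR) (n m : nat) (pi : computation) (x : cmd * store) (i : nat).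
Hypothesis gap : forall i, (i <= n)%N ->
  e <= delta 0 i /\ forall j, j != i -> e <= `|delta 0 i - delta 0 j|.
Hypotheses (vpi : valid pi) (xpi : at_config pi x) (mpi : first k (tail pi 1) m).
Hypotheses (ik : (i < k)%N) (sn : (x.2 i < n)%N).

Lemma config_first : first i pi (x.2 i).+1.
Proof.
have [c0 r0] := xpi; apply/first_succ; last exact: r0.
by apply: vpi c0 ik; rewrite leqW // leq_addr.
Qed.

Lemma mark_notin : i \notin tail pi m.+1 0%N.
Proof.
have [km _] := mpi; apply: (vpi (leqnn k) _ ik).
by move: km; rewrite /tail addn0 add1n.
Qed.

Lemma detects_keep : detects e (FKeep i) i (x.2 i) pi m.
Proof.
have [_ /(_ i ik) hi] := xpi.
apply: detectsI.
- by rewrite sem_neq (sem_nextmark_first delta_disc _ mpi) !sem_next (sem_dist_first delta_disc hi).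
- by move=> h; rewrite (sem_dist_first delta_disc h).
- by apply: detect_dist gap _; apply: ltnW.
Qed.

(** Since [sn] is strict, the incremented value is still at most [n], where [gap] applies. *)
Lemma detects_up : detects e (FUp i) i (x.2 i).+1 pi m.
Proof.
apply: detectsI.
- by rewrite sem_neq (sem_nextmark_first delta_disc _ mpi) !sem_next (sem_dist_first delta_disc config_first).
- by move=> h; rewrite (sem_dist_first delta_disc h).
- exact: detect_dist gap _.
Qed.

Lemma detects_down v : x.2 i = v.+1 -> detects e (FDown i) i v pi m.
Proof.
move=> sv; have [_ /(_ i ik) hi] := xpi; rewrite sv in hi.
apply: detectsI.
- by rewrite sem_neq (sem_nextmark_first delta_disc _ mpi) !sem_next (sem_dist_first delta_disc hi).
- by move=> /(first_succ _ mark_notin) h; rewrite (sem_dist_first delta_disc h).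
- have [h|h] := detect_dist i (tail pi m.+1) gap (ltnW sn); rewrite -?sv; [left|by right].
  by apply/(first_succ _ mark_notin); rewrite -sv.
Qed.
End Step.

(** A missing next configuration or a wrong control state makes the first disjunct 1, which is
    enough as [e <= 1]; a wrong register [i] is caught by [F i]. *)
Lemma bad_step e c (s : store) F pi : e <= 1 ->
  (forall m i, first k (tail pi 1) m -> (i < k)%N -> detects e (F i) i (s i) pi m) ->
  (1 / 2 + e / 2 <= sem delta (FBadStep c F) pi \/
   exists m, at_config (tail pi m.+1) (c, s)) /\
  (forall m, first k (tail pi 1) m -> at_config (tail pi m.+1) (c, s) ->
   sem delta (FBadStep c F) pi <= 1 / 2).
Proof.
move=> e1 hF; split; last first.
  move=> m km [cm rm]; rewrite sem_or ge_max sem_neg.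
  rewrite (sem_nextmark_first delta_disc _ km) sem_atom cm subrr divr_ge0 //=.
  apply: sem_bigor_map_le => [|i]; first by rewrite divr_ge0.
  by rewrite mem_iota => ik; have [h _] := hF m i km ik; apply/h/rm.
have [[m km]|nev] := firstP k (tail pi 1); last first.
  left; rewrite sem_or le_max sem_neg.
  by rewrite (sem_nextmark_never delta_disc _ nev) subr0; apply/orP; left; lra.
have [cm|cm] := boolP ((k.+1 + index c cs)%N \in tail pi m.+1 0%N); last first.
  left; rewrite sem_or le_max sem_neg.
  rewrite (sem_nextmark_first delta_disc _ km) sem_atom (negbTE cm) subr0.
  by apply/orP; left; lra.
have [rm|] := pselect (forall i, (i < k)%N -> first i (tail (tail pi m.+1) 1) (s i)).
  by right; exists m.
move=> /existsNP[i] /not_implyP[ik ni]; left.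
have [_ [//|h]] := hF m i km ik; apply: le_trans h _.
rewrite sem_or le_max; apply/orP; right.
by apply: (sem_bigor_map_ge); rewrite mem_iota.
Qed.

Lemma bad_body e n pi c s : e <= 1 ->
  (forall i, (i <= n)%N ->
     e <= delta 0 i /\ forall j, j != i -> e <= `|delta 0 i - delta 0 j|) ->
  c != Done -> regs_below k c -> (forall i, (i < k)%N -> (s i < n)%N) ->
  valid pi -> at_config pi (c, s) ->
  (1 / 2 + e / 2 <= sem delta (FBadBody c) pi \/
   exists m, at_config (tail pi m.+1) (cstep (c, s))) /\
  (forall m, first k (tail pi 1) m -> at_config (tail pi m.+1) (cstep (c, s)) ->
   sem delta (FBadBody c) pi <= 1 / 2).
Proof.
move=> e1 gap; case: c => [|r d|r b d]; first (by rewrite eqxx); move=> _; rewrite [regs_below _ _]/= [cstep _]/=.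
- move=> /andP[rk _] sn vpi xpi; apply: bad_step => // m i km ik; rewrite /upd.
  case: eqP => [->|_]; first exact: (detects_up gap vpi xpi km rk (sn _ rk)).
  exact: (detects_keep gap xpi km ik (sn _ ik)).
move=> /and3P[rk _ _] sn vpi xpi; have fr : first r (tail pi 1) (s r) by have [_] := xpi; apply.
have semr : sem delta (FNext (FAtom r)) pi = (s r == 0%N)%:R.
  rewrite sem_next sem_atom; congr (_%:R).
  by case: (s r) fr => [|v] [h1 h2]; [rewrite h1|rewrite (negbTE (h2 0%N _))].
(* The zero test is two-valued here, so one branch of the disjunction vanishes and the other keeps
   its value. *)
have semE : sem delta (FBadBody (Loop r b d)) pi = if s r == 0%N then
    sem delta (FBadStep d FKeep) pi else
    sem delta (FBadStep (b ;; Loop r b d) (fun i => if i == r then FDown i else FKeep i)) pi.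
  rewrite [FBadBody _]/= sem_or !sem_and sem_neg semr.
  case: eqP => _; rewrite ?subrr ?subr0.
    rewrite (min_idPr (sem_le1 delta_disc _ _)) (min_idPl (sem_ge0 delta_disc _ _)).
    by rewrite (max_idPl (sem_ge0 delta_disc _ _)).
  rewrite (min_idPl (sem_ge0 delta_disc _ _)) (min_idPr (sem_le1 delta_disc _ _)).
  by rewrite (max_idPr (sem_ge0 delta_disc _ _)).
rewrite semE; case sr : (s r) => [|v] /=.
- apply: bad_step => // m i km ik; exact: (detects_keep gap xpi km ik (sn _ ik)).
- apply: bad_step => // m i km ik; rewrite /upd.
  case: eqP => [->|_]; first exact: (detects_down gap vpi xpi km rk (sn _ rk) sr).
  exact: (detects_keep gap xpi km ik (sn _ ik)).
Qed.
End Reduction.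

(** * The Kripke structure of all words over a finite alphabet *)

Definition complete_kripke (ls : seq (seq nat)) : kripke :=
  let n := size ls in
  Kripke n (iota 0 n) [seq (i, j) | i <- iota 0 n, j <- iota 0 n] ls.

Lemma complete_kripke_wf ls : ls != [::] -> kripke_wf (complete_kripke ls).
Proof.
rewrite -size_eq0 -lt0n => n0; split => //.
- by apply/allP => s; rewrite mem_iota.
- by rewrite -size_eq0 size_iota -lt0n.
- by apply/allP => p /allpairsP[[i j] []]; rewrite !mem_iota => /= hi hj -> /=; rewrite hi.
- by move=> s sn; exists 0; apply/allpairsP; exists (s, 0); rewrite !mem_iota.
Qed.

(** The structure does not constrain the order of letters: judging runs is left entirely to the
    formula. *)
Lemma complete_kripke_computation ls pi :
  is_computation (complete_kripke ls) pi <-> forall t, pi t \in ls.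
Proof.
split=> [[s [[h0 hS] ->]] t|h].
  apply: mem_nth; have /allpairsP[[i j] /= [hi _ [-> _]]] := hS t.
  by move: hi; rewrite mem_iota.
exists (fun t => index (pi t) ls); split; last first.
  by apply: funext => t; rewrite nth_index.
split=> [|i] /=; first by rewrite mem_iota index_mem h.
by apply/allpairsP; exists (index (pi i) ls, index (pi i.+1) ls); rewrite !mem_iota !index_mem !h.
Qed.

Definition letters (k : nat) (cs : seq cmd) : seq (seq nat) :=
  [seq [:: k; k.+1 + index c cs] | c <- cs] ++
  [seq mask (val m) (iota 0 k) | m : k.-tuple bool].

Lemma letters_valid k cs pi : (forall t, pi t \in letters k cs) -> valid k pi.
Proof.
move=> h t a i ka; have := h t; rewrite mem_cat => /orP[/mapP[c _ ->] _ ik|].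
  by rewrite !inE; apply/norP; split; lia.
by move=> /mapP[m _ ->] /mem_mask; rewrite mem_iota; lia.
Qed.

Lemma filter_letters k cs P : [seq i <- iota 0 k | P i] \in letters k cs.
Proof.
rewrite mem_cat filter_mask; apply/orP; right; apply/mapP.
have sz : size (map P (iota 0 k)) == k by rewrite size_map size_iota.
by exists (Tuple sz); rewrite ?mem_enum.
Qed.

Lemma cstep_succs c s : c != Done -> (cstep (c, s)).1 \in succs c.
Proof.
case: c => [|r c|r b c]; rewrite ?eqxx // => _ /=; first by rewrite inE.
by case: (s r) => [|v]; rewrite !inE eqxx ?orbT.
Qed.

(** The number of letters that follow the opening one in the block of a configuration; strictly
    above every register, it leaves room for all atoms and is also the range to which [delta_gap] is
    applied. *)
Definition reg_bound k (s : store) := (\max_(i < k) s i).+1.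

Lemma lt_reg_bound k s i : i < k -> s i < reg_bound k s.
Proof. by move=> ik; rewrite ltnS (leq_bigmax (Ordinal ik)). Qed.

(** * Correctness of the reduction *)

Section Correctness.
Local Open Scope ring_scope.
Variables (k : nat) (cs : seq cmd).
Hypothesis cs_regs : all (regs_below k) cs.
Hypothesis cs_closed : forall c, c \in cs -> {subset succs c <= cs}.
Variable delta : nat -> nat -> RR.
Hypothesis delta_disc : forall e, discounting (delta e).

Lemma iter_cstep_mem n x : x.1 \in cs -> (iter n cstep x).1 \in cs.
Proof.
move=> x0; elim: n => //= n; case: (iter n cstep x) => c s /= cc.
have [c0|c0] := eqVneq c Done; last exact: (cs_closed cc (cstep_succs s c0)).
by rewrite c0 in cc *.
Qed.

Lemma bad_run_tail pi m :
  sem delta (FBadRun k cs) (tail pi m) <= sem delta (FBadRun k cs) pi.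
Proof.
by apply: sem_eventually_le => i; rewrite tail_tail; apply: sem_eventually_ge.
Qed.

Lemma bad_run_ge pi c s : c \in cs -> at_config k cs pi (c, s) ->
  sem delta (FBadBody k cs c) pi <= sem delta (FBadRun k cs) pi.
Proof.
move=> cc [cpi _]; have := sem_eventually_ge delta_disc (FBigOr (map (FBad k cs) cs)) pi 0.
apply: le_trans; rewrite tail0.
apply: le_trans (sem_bigor_map_ge delta (FBad k cs) pi cc).
by rewrite sem_and sem_atom cpi (min_idPr (sem_le1 delta_disc _ _)).
Qed.

(** Induction on the steps left. A word either errs at this configuration, by an amount bounded
    through the gap for its register values, or encodes the next one, and the induction hypothesis
    applies to a tail. The bound depends on the run and not on [pi]. *)
Lemma halting_bad_run n c s : c \in cs -> (iter n cstep (c, s)).1 = Done ->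
  exists2 e : RR, 0 < e & forall pi, valid k pi -> at_config k cs pi (c, s) ->
    1 / 2 + e <= sem delta (FBadRun k cs) pi.
Proof.
elim: n c s => [|n IH] c s cc hn.
  exists (1 / 2) => [|pi _ /(bad_run_ge cc)]; [by rewrite divr_gt0|rewrite -[c]/(c, s).1 [(c, s).1]hn].
  by apply: le_trans => /=; lra.
have [c0|c0] := eqVneq c Done.
  exists (1 / 2) => [|pi _ /(bad_run_ge cc)]; [by rewrite divr_gt0|rewrite c0].
  by apply: le_trans => /=; lra.
have cc' : (cstep (c, s)).1 \in cs by apply: (cs_closed cc (cstep_succs s c0)).
have [e1 e1_gt0 gap] := delta_gap delta_disc (reg_bound k s).
have [e2 e2_gt0 step] : exists2 e : RR, 0 < e & forall pi, valid k pi ->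
    at_config k cs pi (cstep (c, s)) -> 1 / 2 + e <= sem delta (FBadRun k cs) pi.
  by move: hn; rewrite iterSr; case: (cstep _) cc' => c' s'; apply: IH.
exists (Num.min (e1 / 2) e2) => [|pi vpi xpi]; first by rewrite lt_min e2_gt0 divr_gt0.
have e1_le1 : e1 <= 1.
  by have [h _] := gap 0%N isT; apply: le_trans h (delta_le1 delta_disc _ _).
have sn i : (i < k)%N -> (s i < reg_bound k s)%N by apply: lt_reg_bound.
have [[h|[m hm]] _] := bad_body delta_disc e1_le1 gap c0 (allP cs_regs _ cc) sn vpi xpi.
  apply: le_trans (bad_run_ge cc xpi); apply: le_trans h.
  by rewrite lerD2l ge_min lexx.
apply: le_trans (bad_run_tail _ m.+1); apply: le_trans (step _ (valid_tail vpi) hm).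
by rewrite lerD2l ge_min lexx orbT.
Qed.

(** Offset 0 is the opening letter; offset [j.+1] lists the registers with value [j], so each
    register atom occurs once in a block. *)
Definition letter (g : (cmd * store) * nat) : seq nat :=
  if g.2 is j.+1 then [seq i <- iota 0 k | g.1.2 i == j]
  else [:: k; (k.+1 + index g.1.1 cs)%N].

Definition next_letter (g : (cmd * store) * nat) : (cmd * store) * nat :=
  if (g.2 < reg_bound k g.1.2)%N then (g.1, g.2.+1) else (cstep g.1, 0%N).

(* The encoding of the run from [g.1], started at offset [g.2] of its first block. *)
Definition run_word g : computation := fun t => letter (iter t next_letter g).

Lemma tail_run_word g t : tail (run_word g) t = run_word (iter t next_letter g).
Proof. by apply: funext => u; rewrite /run_word /tail addnC iterD. Qed.

Lemma iter_next_letter x j : (j <= reg_bound k x.2)%N -> iter j next_letter (x, 0%N) = (x, j).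
Proof.
by elim: j => //= j IH hj; rewrite IH ?(ltnW hj) // /next_letter hj.
Qed.

Lemma iter_next_block x :
  iter (reg_bound k x.2).+1 next_letter (x, 0%N) = (cstep x, 0%N).
Proof. by rewrite iterS iter_next_letter // /next_letter ltnn. Qed.

Lemma run_word_in_block x j : (j < reg_bound k x.2)%N ->
  tail (run_word (x, 0%N)) 1 j = [seq i <- iota 0 k | x.2 i == j].
Proof. by move=> hj; rewrite /tail /run_word add1n iter_next_letter. Qed.

Lemma at_config_run_word x : at_config k cs (run_word (x, 0%N)) x.
Proof.
split=> [|i ik]; first by rewrite !inE eqxx orbT.
have hi := lt_reg_bound x.2 ik; split.
  by rewrite run_word_in_block // mem_filter eqxx mem_iota.
move=> j hj; rewrite run_word_in_block ?mem_filter; last exact: ltn_trans hj hi.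
by rewrite gtn_eqF.
Qed.

Lemma mark_run_word x : first k (tail (run_word (x, 0%N)) 1) (reg_bound k x.2).
Proof.
split; last by move=> j hj; rewrite run_word_in_block // mem_filter mem_iota ltnn !andbF.
by rewrite /tail add1n /run_word iter_next_block inE eqxx.
Qed.

Lemma run_word_letters x j t : x.1 \in cs -> run_word (x, j) t \in letters k cs.
Proof.
move=> cx; rewrite /run_word.
have : (iter t next_letter (x, j)).1.1 \in cs.
  elim: t => //= t; rewrite /next_letter; case: ifP => // _.
  exact: (iter_cstep_mem 1).
case: (iter t _ _) => [[c s] [|i]] /= cc; last exact: filter_letters.
by rewrite mem_cat; apply/orP; left; apply/mapP; exists c.
Qed.

(** Inside a block no state atom holds and every disjunct is 0. At an opening letter only the
    disjunct of the actual control state survives, [index] being injective on [cs], and it is at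
    most 1/2 since the next block encodes the successor. *)
Lemma sem_run_word x : x.1 \in cs -> (forall n, (iter n cstep x).1 <> Done) ->
  sem delta (FBadRun k cs) (run_word (x, 0%N)) <= 1 / 2.
Proof.
move=> cx nh; apply: sem_eventually_le => t; rewrite tail_run_word.
have [n [j ->]] : exists n j, iter t next_letter (x, 0%N) = (iter n cstep x, j).
  elim: t => [|t [n [j IH]]]; first by exists 0%N, 0%N.
  rewrite iterS IH /next_letter; case: ifP => _; first by exists n, j.+1.
  by exists n.+1, 0%N.
have := iter_cstep_mem n cx; have /eqP := nh n.
case: (iter n cstep x) => c s /= c0 cc {x cx nh n t}.
apply: sem_bigor_map_le => [|d dc]; first by rewrite divr_ge0.
rewrite sem_and ge_min sem_atom; case: j => [|j]; last first.
  by rewrite [_ \in _](_ : _ = false) ?divr_ge0 // mem_filter mem_iota; apply/negbTE; lia.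
have [->|dc'] := eqVneq d c; last first.
  rewrite [_ \in _](_ : _ = false) ?divr_ge0 // !inE eqn_add2l.
  rewrite (_ : (k.+1 + _ == k)%N = false) /=; last by lia.
  apply/negbTE; apply: contra dc' => /eqP h.
  by rewrite -(nth_index Done dc) -(nth_index Done cc) h.
have [e1 e1_gt0 gap] := delta_gap delta_disc (reg_bound k s).
have e1_le1 : e1 <= 1.
  by have [h _] := gap 0%N isT; apply: le_trans h (delta_le1 delta_disc _ _).
have sn i : (i < k)%N -> (s i < reg_bound k s)%N by apply: lt_reg_bound.
have v : valid k (run_word ((c, s), 0%N)).
  by apply: (@letters_valid _ cs) => t; apply: run_word_letters.
have [_ h] := bad_body delta_disc e1_le1 gap c0 (allP cs_regs _ cc) sn v
  (at_config_run_word _).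
rewrite (h _ (mark_run_word _)) ?orbT //.
by rewrite tail_run_word iter_next_block; apply: at_config_run_word.
Qed.

Lemma sem_not_input n pi :
  (first 0 pi n -> sem delta (FNotInput n) pi = 0) /\
  (first 0 pi n \/ sem delta (FNotInput n) pi = 1).
Proof.
elim: n pi => [|n IH] pi.
  rewrite sem_neg sem_atom; case: (boolP (0%N \in pi 0%N)) => h.
    by split=> [_|]; [rewrite subrr|left; split].
  by split=> [[]|]; [rewrite (negbTE h)|right; rewrite subr0].
have [h1 h2] := IH (tail pi 1).
rewrite [FNotInput _]/= sem_or sem_atom sem_next.
have [a0|a0] := boolP (0%N \in pi 0%N).
  split; first by move=> [_ /(_ 0%N isT)]; rewrite a0.
  by right; rewrite (max_idPl (sem_le1 delta_disc _ _)).
rewrite (max_idPr (sem_ge0 delta_disc _ _)); split.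
  by move=> /(first_succ _ a0); apply: h1.
by case: h2 => h; [left; apply/(first_succ _ a0)|right].
Qed.

Hypothesis k_gt0 : (0 < k)%N.

Lemma instance_halting c x : c \in cs -> halts c (input x) ->
  exists2 e : RR, 0 < e & forall pi, valid k pi ->
    1 / 2 + e <= sem delta (FInstance k cs c x) pi.
Proof.
move=> cc [n hn]; have [e e0 he] := halting_bad_run cc hn.
(* The cap 1/2 is there because a word violating the initial conditions only reaches the value 1. *)
exists (Num.min e (1 / 2)) => [|pi v]; first by rewrite lt_min e0 divr_gt0.
have top : 1 / 2 + Num.min e (1 / 2) <= 1.
  have : Num.min e (1 / 2) <= 1 / 2 by rewrite ge_min lexx orbT.
  by lra.
rewrite !sem_or !le_max sem_next sem_neg sem_atom.
have [_ [f0|->]] := sem_not_input x (tail pi 1); last by rewrite top.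
have [cpi|_] := boolP (_ \in pi 0%N); last by rewrite subr0 top orbT.
have [xpi|] := pselect (at_config k cs pi (c, input x)).
  by rewrite (le_trans _ (he pi v xpi)) ?orbT // lerD2l ge_min lexx.
move=> nx; have : ~ forall i, (i < k)%N -> first i (tail pi 1) (input x i) by move=> h; apply: nx.
move=> /existsNP[i] /not_implyP[ik ni]; apply/orP; right; apply/orP; left; apply/orP; right.
have i0 : (0 < i)%N by case: i ik ni => // _.
have ii : i \in iota 1 k.-1 by rewrite mem_iota; lia.
apply: le_trans (sem_bigor_map_ge delta (fun i => FNeg (FNext (FAtom i))) pi ii).
rewrite sem_neg sem_next sem_atom.
have [h|_] := boolP (_ \in _); last by rewrite subr0.
by case: ni; rewrite /input /upd gtn_eqF.
Qed.

Lemma instance_diverging c x : c \in cs -> ~ halts c (input x) ->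
  sem delta (FInstance k cs c x) (run_word ((c, input x), 0%N)) <= 1 / 2.
Proof.
move=> cc nh; set pi := run_word _.
have [c0 r0] : at_config k cs pi (c, input x) by apply: at_config_run_word.
have half : 0 <= 1 / 2 :> RR by rewrite divr_ge0.
rewrite !sem_or !ge_max sem_next sem_neg sem_atom c0 subrr half.
have [h _] := sem_not_input x (tail pi 1); rewrite (h (r0 _ k_gt0)) half /=.
apply/andP; split; last by apply: sem_run_word => // n hn; apply: nh; exists n.
apply: sem_bigor_map_le => // i; rewrite mem_iota => /andP[i0 ik].
have [|h0 _] := r0 i; first by lia.
rewrite sem_neg sem_next sem_atom (_ : i \in _) ?subrr //.
by move: h0; rewrite /= /input /upd gtn_eqF.
Qed.

(** In the diverging case one computation of value at most 1/2 bounds the infimum. In the halting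
    case [e] is uniform over computations, so the strict inequality survives the infimum. *)
Lemma strict_mc_halting c x : c \in cs ->
  strict_mc delta (complete_kripke (letters k cs)) (FInstance k cs c x) 1 2 <->
  halts c (input x).
Proof.
move=> cc; rewrite /strict_mc /kval; split=> [lt|/(instance_halting cc)[e e0 he]].
  apply: contrapT => /(instance_diverging cc); apply/negP; rewrite -ltNge.
  apply: lt_le_trans lt _; apply: ge_inf.
    by exists 0 => _ [pi _ <-]; apply: sem_ge0.
  exists (run_word ((c, input x), 0%N)) => //.
  by apply/complete_kripke_computation => t; apply: run_word_letters.
apply: (@lt_le_trans _ _ (1 / 2 + e)); first by rewrite ltrDl.
apply: lb_le_inf.
  exists (sem delta (FInstance k cs c x) (run_word ((c, input x), 0%N))).
  exists (run_word ((c, input x), 0%N)) => //.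
  by apply/complete_kripke_computation => t; apply: run_word_letters.
by move=> _ [pi /complete_kripke_computation/letters_valid v <-]; apply: he.
Qed.
End Correctness.

(** * Diagonalization *)

Fixpoint const_prog n := if n is m.+1 then PComp PSucc (const_prog m) else PZero.

Lemma eval_const n x : eval (const_prog n) x n.
Proof.
by elim: n => [|n IH]; [apply: ev_zero|apply: ev_comp IH (ev_succ _)].
Qed.

(** Follows the recursion of [FNotInput]: 3 and 4 are the tags of [FOr] and [FNext], and
    [PComp PFst PSnd] fetches the previous value. *)
Definition not_input_prog : prog :=
  PRec (const_prog (enc_ltl (FNotInput 0)))
    (PPair (const_prog 3) (PPair (const_prog (enc_ltl (FAtom 0)))
      (PPair (const_prog 4) (PComp PFst PSnd)))).

Lemma eval_not_input n x : eval not_input_prog (cpair n x) (enc_ltl (FNotInput n)).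
Proof.
elim: n => [|n IH]; first by apply: ev_rec0; apply: eval_const.
apply: ev_recS IH _; do 3 (apply: ev_pair; first exact: eval_const).
apply: ev_comp; first exact: ev_snd.
by rewrite cpairK; have := ev_fst (cpair (enc_ltl (FNotInput n)) x); rewrite cpairK.
Qed.

(* On [x = cpair u v], with [u] the code of a Kripke structure [K] and [v] that of
   [FSpec k cs c], computes the code of the instance [(K, FInstance k cs c x, 1/2)]. *)
Definition instance_prog : prog :=
  PPair PFst
    (PPair
      (PPair (const_prog 3)
        (PPair (PPair (const_prog 4) (PComp not_input_prog (PPair PId PId))) PSnd))
      (const_prog (cpair 1 2))).

Lemma eval_instance K k cs c :
  let x := cpair (enc_kripke K) (enc_ltl (FSpec k cs c)) in
  eval instance_prog x (enc_instance K (FInstance k cs c x) 1 2).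
Proof.
move=> x; have e1 : enc_kripke K = (cunpair x).1 by rewrite cpairK.
have e2 : enc_ltl (FSpec k cs c) = (cunpair x).2 by rewrite cpairK.
rewrite /enc_instance (_ : enc_ltl (FInstance _ _ _ _) =
  cpair 3 (cpair (cpair 4 (enc_ltl (FNotInput x))) (enc_ltl (FSpec k cs c)))) // e1 e2.
apply: ev_pair; first exact: ev_fst.
apply: ev_pair; last exact: eval_const.
apply: ev_pair; first exact: eval_const.
apply: ev_pair; last exact: ev_snd.
apply: ev_pair; first exact: eval_const.
by apply: ev_comp (eval_not_input _ _); apply: ev_pair; apply: ev_id.
Qed.

Theorem theorem6 (D : set (nat -> RR)) :
  (forall eta, D eta -> discounting eta) ->
  (exists eta, D eta) ->
  forall delta : nat -> (nat -> RR), (forall e, D (delta e)) ->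
  ~ (exists c : prog, decides_strict_mc delta c).
Proof.
move=> D_disc _ delta deltaD [c dec].
have delta_disc e : discounting (delta e) by apply/D_disc/deltaD.
pose p := PComp c instance_prog; pose M := diag_cmd p.
have [m regsM] := regs_below_exists M.
pose cs := controls M; pose K := complete_kripke (letters m.+1 cs).
(* [K] and [FSpec] do not mention the input, so this is not circular; the instance computed from [x]
   is the one that holds exactly when [M] halts on [x]. *)
pose x := cpair (enc_kripke K) (enc_ltl (FSpec m.+1 cs M)).
have evp y : eval c (enc_instance K (FInstance m.+1 cs M x) 1 2) y -> eval p x y.
  exact: ev_comp (eval_instance _ _ _ _).
have wfK : kripke_wf K by apply: complete_kripke_wf.
have [yes no] := dec K (FInstance m.+1 cs M x) 1 2 wfK isT isT.
have mcP := strict_mc_halting (regs_below_controls regsM) (@controls_closed M)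
  delta_disc (ltn0Sn m) x (mem_controls M).
have [mc|nmc] := pselect (strict_mc delta K (FInstance m.+1 cs M x) 1 2).
  by apply: (diag_diverges (evp _ (yes mc))); apply/mcP.
by apply/nmc/mcP/diag_halts/evp/no.
Qed.
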